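(* Let $J_2=\langle a_1,b_1,a_2,b_2\mid [a_1,b_1][a_2,b_2]\rangle$ be the fundamental group of the closed orientable surface of genus $2$, with symmetric generating set $S=\{a_1^{\pm1},b_1^{\pm1},a_2^{\pm1},b_2^{\pm1}\}$. The spectral radius $\mu_2$ of the simple random walk on the Cayley graph $\mathrm{Cay}(J_2,S)$ satisfies $\mu_2\ge 0.6623$.
   Context: For a connected $d$-regular graph with base vertex $*$, the simple random walk moves from a vertex to each of its $d$ neighbours with probability $1/d$; with $p^{(n)}( *,* )$ the probability of returning to $*$ after $n$ steps, the spectral radius is $\mu=\limsup_{n\to\infty}p^{(n)}( *,* )^{1/n}$ (equal to the norm of the Markov operator on $\ell^2$). The Cayley graph has vertex set $J_2$ and edges $\{g,gs\}$, $g\in J_2$, $s\in S$; here it is $8$-regular. $[a,b]=aba^{-1}b^{-1}$. *)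

(* Defs.v *)
From Stdlib Require Import Reals List Relations ClassicalEpsilon.
From Coquelicot Require Import Coquelicot.
Import ListNotations.
Open Scope R_scope.

Inductive gen : Type := a1 | b1 | a2 | b2.

(* A letter is a generator together with a flag: false = g, true = g^{-1}. *)
Definition letter : Type := (gen * bool)%type.

Definition linv (x : letter) : letter := (fst x, negb (snd x)).

Definition S_letters : list letter :=
  [(a1,false); (a1,true); (b1,false); (b1,true);
   (a2,false); (a2,true); (b2,false); (b2,true)].

(* Relator [a1,b1][a2,b2] with [a,b] = a b a^{-1} b^{-1}. *)
Definition relator : list letter :=
  [(a1,false); (b1,false); (a1,true); (b1,true);
   (a2,false); (b2,false); (a2,true); (b2,true)].

Inductive elem_move : list letter -> list letter -> Prop :=
| move_free : forall u v x, elem_move (u ++ [x; linv x] ++ v) (u ++ v)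
| move_rel  : forall u v, elem_move (u ++ relator ++ v) (u ++ v).

Definition J2_eq : list letter -> list letter -> Prop :=
  clos_refl_sym_trans (list letter) elem_move.

Definition J2_trivial (w : list letter) : Prop := J2_eq w [].

Definition indic (P : Prop) : R :=
  if excluded_middle_informative P then 1 else 0.

(* ret n w = probability that the simple random walk on Cay(J_2,S) started at
   the vertex represented by w is at the identity * after n steps
   (a step moves g to g s, s uniform in S). *)
Fixpoint ret (n : nat) (w : list letter) : R :=
  match n with
  | O => indic (J2_trivial w)
  | Datatypes.S k => / 8 * fold_right Rplus 0 (map (fun s => ret k (w ++ [s])) S_letters)
  end.

Definition return_prob (n : nat) : R := ret n [].

Definition nth_root (x : R) (n : nat) : R :=
  if Req_EM_T x 0 then 0 else Rpower x (/ INR n).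

Definition spectral_radius_J2 : Rbar :=
  LimSup_seq (fun n => nth_root (return_prob n) n).

(* Main.v *)
(** If the limsup were smaller than [a = 0.6623], the Green function
    [G(w) = sum_n ret n w a^(-n)] would be a finite positive function on the
    group whose eight neighbour values sum to at most [L G(w)], [L = 8 a].
    Let [r] be the largest constant with [G(ws) >= r G(w)] for all [w] and [s].
    Keeping a few neighbours of a vertex and bounding the others below by [r]
    gives new such constants, which cannot exceed [r].  The edge alone gives
    [r (L - 7 r) >= 1], as on the 8-regular tree, and confines [r] to a short
    interval.  Taking into account the two octagons through an edge, read off
    from the relator and from its inverse, gives a second inequality that
    fails on this interval. *)

Require Import Defs.
From Stdlib Require Import Reals Lra Lia List Relations ClassicalEpsilon.
From Coquelicot Require Import Coquelicot.
Import ListNotations.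
Open Scope R_scope.

(** * Words and relations in the surface group *)

Definition winv (w : list letter) : list letter := rev (map linv w).

Lemma In_S_letters (x : letter) : In x S_letters.
Proof. destruct x as [[] []]; simpl; tauto. Qed.

Lemma J2_eq_sym u v : J2_eq u v -> J2_eq v u.
Proof. apply rst_sym. Qed.

Lemma J2_eq_trans u v w : J2_eq u v -> J2_eq v w -> J2_eq u w.
Proof. apply rst_trans. Qed.

Lemma J2_eq_context p s u v : J2_eq u v -> J2_eq (p ++ u ++ s) (p ++ v ++ s).
Proof.
  induction 1 as [u v H | u | u v _ IH | u v w _ IH1 _ IH2].
  - apply rst_step. destruct H as [a b x | a b]; rewrite <- !app_assoc, !(app_assoc p a).
    + apply (move_free (p ++ a) (b ++ s) x).
    + apply (move_rel (p ++ a) (b ++ s)).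
  - apply rst_refl.
  - now apply rst_sym.
  - eapply rst_trans; eassumption.
Qed.

Lemma J2_trivial_context p s u : J2_trivial u -> J2_eq (p ++ u ++ s) (p ++ s).
Proof. apply (J2_eq_context p s u []). Qed.

Lemma J2_trivial_cancel x : J2_trivial [x; linv x].
Proof. apply rst_step, (move_free [] [] x). Qed.

Lemma J2_trivial_app_winv w : J2_trivial (w ++ winv w).
Proof.
  unfold winv; induction w as [| x w IH]; simpl.
  - apply rst_refl.
  - eapply J2_eq_trans; [| apply (J2_trivial_cancel x)].
    rewrite app_assoc. exact (J2_trivial_context [x] [linv x] _ IH).
Qed.

(** Conjugation: [v u] equals [v (u v) v^-1]. It supplies the octagons starting at any letter of the
    relator. *)
Lemma J2_trivial_rotate u v : J2_trivial (u ++ v) -> J2_trivial (v ++ u).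
Proof.
  intros H.
  apply J2_eq_trans with (v ++ (u ++ v) ++ winv v).
  - apply J2_eq_sym. rewrite <- app_assoc, app_assoc.
    pose proof (J2_trivial_context (v ++ u) [] _ (J2_trivial_app_winv v)) as K.
    now rewrite !app_nil_r in K.
  - eapply J2_eq_trans; [apply (J2_trivial_context v (winv v) _ H) |].
    apply J2_trivial_app_winv.
Qed.

Lemma J2_trivial_winv w : J2_trivial w -> J2_trivial (winv w).
Proof.
  intros H. eapply J2_eq_trans; [| apply (J2_trivial_app_winv w)].
  apply J2_eq_sym, (J2_trivial_context [] (winv w) _ H).
Qed.

Lemma J2_trivial_relator : J2_trivial relator.
Proof. apply rst_step, (move_rel [] []). Qed.

(** * Sums over the eight letters *)

Definition letter_sum (f : letter -> R) : R := fold_right Rplus 0 (map f S_letters).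

Lemma fold_right_Rplus_app (l l' : list R) :
  fold_right Rplus 0 (l ++ l') = fold_right Rplus 0 l + fold_right Rplus 0 l'.
Proof. induction l as [| a l IH]; simpl; [| rewrite IH]; ring. Qed.

Lemma sum_incl_le {A : Type} (g : A -> R) (l l' : list A) :
  (forall x, 0 <= g x) -> NoDup l -> incl l l' ->
  fold_right Rplus 0 (map g l) <= fold_right Rplus 0 (map g l').
Proof.
  intros g0. revert l'. induction l as [| x l IH]; intros l' ND Hi; simpl.
  - clear Hi. induction l' as [| y l' IH]; simpl; [lra |]. specialize (g0 y); lra.
  - inversion ND as [| ? ? Hx NDl]; subst.
    destruct (in_split x l' (Hi x (or_introl eq_refl))) as [p [s ->]].
    assert (Hi' : incl l (p ++ s)).
    { intros y Hy. assert (K := Hi y (or_intror Hy)).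
      apply in_app_or in K. apply in_or_app. destruct K as [K | [-> | K]]; tauto. }
    specialize (IH _ NDl Hi').
    rewrite map_app, fold_right_Rplus_app in *. simpl. lra.
Qed.

Lemma sum_minus_const {A : Type} (f : A -> R) (m : R) (l : list A) :
  fold_right Rplus 0 (map (fun x => f x - m) l)
  = fold_right Rplus 0 (map f l) - INR (length l) * m.
Proof.
  induction l as [| x l IH]; [simpl; ring |].
  simpl length. rewrite S_INR. simpl. rewrite IH. ring.
Qed.

(** After subtracting [m] from every term, dropping the letters outside [l] only decreases the
    sum. *)
Lemma letter_sum_ge (f : letter -> R) (m : R) (l : list letter) :
  (forall x, m <= f x) -> NoDup l ->
  fold_right Rplus 0 (map f l) + (8 - INR (length l)) * m <= letter_sum f.
Proof.
  intros Hm ND.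
  assert (H : fold_right Rplus 0 (map (fun x => f x - m) l)
              <= fold_right Rplus 0 (map (fun x => f x - m) S_letters)).
  { apply sum_incl_le; [intros x; specialize (Hm x); lra | easy |].
    intros x _. apply In_S_letters. }
  rewrite !sum_minus_const in H.
  replace (INR (length S_letters)) with 8 in H by (simpl; ring).
  unfold letter_sum. lra.
Qed.

(** * Positive superharmonic functions on the Cayley graph *)

Section Superharmonic.

Variable f : list letter -> R.
Variable L : R.
Hypothesis f_J2 : forall u v, J2_eq u v -> f u = f v.
Hypothesis f_pos : forall w, 0 < f w.
Hypothesis f_super : forall w, letter_sum (fun s => f (w ++ [s])) <= L * f w.

(** A one-step Harnack constant for [f]. *)
Definition edge_bound (r : R) : Prop := forall w x, r * f w <= f (w ++ [x]).

Lemma f_back w x : f ((w ++ [x]) ++ [linv x]) = f w.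
Proof.
  apply f_J2. rewrite <- app_assoc.
  pose proof (J2_trivial_context w [] _ (J2_trivial_cancel x)) as K.
  now rewrite !app_nil_r in K.
Qed.

Lemma f_neighbour_le w x : f (w ++ [x]) <= L * f w.
Proof.
  refine (Rle_trans _ _ _ _ (f_super w)).
  assert (H := letter_sum_ge (fun s => f (w ++ [s])) 0 [x]).
  simpl in H. refine (Rle_trans _ _ _ _ (H _ _)).
  - lra.
  - intros y. apply Rlt_le, f_pos.
  - constructor; [easy | constructor].
Qed.

Lemma superharmonic_const_pos : 0 < L.
Proof.
  assert (H := Rlt_le_trans _ _ _ (f_pos _) (f_neighbour_le [] (a1, false))).
  apply Rmult_lt_reg_r with (f []); [apply f_pos | lra].
Qed.

Lemma edge_bound_inv : edge_bound (/ L).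
Proof.
  intros w x. assert (LP := superharmonic_const_pos).
  assert (H := f_neighbour_le (w ++ [x]) (linv x)). rewrite f_back in H.
  apply Rmult_le_reg_l with L; [easy |]. rewrite <- Rmult_assoc, Rinv_r by lra. lra.
Qed.

Lemma edge_bound_le r : edge_bound r -> r <= L.
Proof.
  intros H. assert (H1 := H [] (a1, false)).
  assert (H2 := f_neighbour_le [] (a1, false)).
  apply Rmult_le_reg_r with (f []); [apply f_pos | lra].
Qed.

(** The supremum is attained, because the condition at each edge is the closed one [r <= f (w ++
    [x]) / f w]. The set is bounded by [L] and contains [/ L]. *)
Lemma best_edge_bound :
  exists r, 0 < r /\ edge_bound r /\ forall r', edge_bound r' -> r' <= r.
Proof.
  destruct (completeness edge_bound) as [r [Hub Hlub]].
  - exists L. intros r. apply edge_bound_le.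
  - exists (/ L). apply edge_bound_inv.
  - exists r. split; [| split].
    + apply Rlt_le_trans with (/ L).
      * apply Rinv_0_lt_compat, superharmonic_const_pos.
      * apply Hub, edge_bound_inv.
    + intros w x.
      enough (r <= f (w ++ [x]) / f w).
      { apply Rmult_le_compat_r with (r := f w) in H; [| apply Rlt_le, f_pos].
        unfold Rdiv in H. rewrite Rmult_assoc, Rinv_l, Rmult_1_r in H; [easy |].
        apply Rgt_not_eq, f_pos. }
      apply Hlub. intros r' Hr'.
      apply Rle_div_r; [apply f_pos | apply Hr'].
    + exact Hub.
Qed.

(** Both values of [f] at a single edge are positive, which forces [0 < b] and permits the
    division. *)
Lemma edge_bound_div a b :
  0 < a -> (forall w x, a * f w <= b * f (w ++ [x])) -> 0 < b /\ edge_bound (a / b).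
Proof.
  intros a0 H.
  assert (b0 : 0 < b).
  { specialize (H [] (a1, false)).
    apply Rmult_lt_reg_r with (f ([] ++ [(a1, false)])); [apply f_pos |].
    rewrite Rmult_0_l. refine (Rlt_le_trans _ _ _ _ H).
    apply Rmult_lt_0_compat; [easy | apply f_pos]. }
  split; [easy |]. intros w x. specialize (H w x).
  apply Rmult_le_reg_l with b; [easy |].
  replace (b * (a / b * f w)) with (a * f w) by (field; lra). easy.
Qed.

(** * Improving a given edge bound *)

Section Bootstrap.

Variable r : R.
Hypothesis r_bound : edge_bound r.

Lemma superharmonic_neighbours w l :
  NoDup l ->
  fold_right Rplus 0 (map (fun s => f (w ++ [s])) l)
  <= (L - (8 - INR (length l)) * r) * f w.
Proof.
  intros ND.
  assert (H := letter_sum_ge (fun s => f (w ++ [s])) (r * f w) l (r_bound w) ND).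
  assert (H1 := f_super w). lra.
Qed.

(** At [w x] only the neighbour [w] is kept; the seven others are bounded below by [r]. *)
Lemma tree_step : 0 < L - 7 * r /\ edge_bound (/ (L - 7 * r)).
Proof.
  rewrite <- (Rmult_1_l (/ _)). apply edge_bound_div; [lra |].
  intros w x.
  assert (H := superharmonic_neighbours (w ++ [x]) [linv x]).
  simpl map in H. rewrite f_back in H. simpl in H.
  enough (f w + 0 <= (L - (8 - 1) * r) * f (w ++ [x])) by lra.
  apply H. constructor; [easy | constructor].
Qed.

(** The condition on [y] makes the step back and the step forward use different letters, so both are
    kept and six neighbours are bounded by [r]. *)
Lemma path_vertex w x y :
  y <> linv x ->
  f w + f ((w ++ [x]) ++ [y]) <= (L - 6 * r) * f (w ++ [x]).
Proof.
  intros N.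
  assert (H := superharmonic_neighbours (w ++ [x]) [linv x; y]).
  simpl map in H. rewrite f_back in H. simpl in H.
  enough (f w + (f ((w ++ [x]) ++ [y]) + 0) <= (L - (8 - (1 + 1)) * r) * f (w ++ [x]))
    by lra.
  apply H. repeat constructor; simpl; intuition congruence.
Qed.

(* [c^4 - 3c^2 + 1] and [c^5 - 4c^3 + 3c] are the characteristic polynomials of
   the paths with 4 and 5 vertices; the octagon [y1 ... y8] leaves a path of 5
   vertices between [w y1] and [w y8^-1]. *)
Lemma octagon_step (w : list letter) (y1 y2 y3 y4 y5 y6 y7 y8 : letter) (c : R) :
  c = L - 6 * r -> 2 <= c ->
  J2_trivial [y1; y2; y3; y4; y5; y6; y7; y8] ->
  y3 <> linv y2 -> y4 <> linv y3 -> y5 <> linv y4 -> y6 <> linv y5 -> y7 <> linv y6 ->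
  (c ^ 4 - 3 * c ^ 2 + 1) * f (w ++ [y1]) + r * f w
  <= (c ^ 5 - 4 * c ^ 3 + 3 * c) * f ((w ++ [y1]) ++ [y2]).
Proof.
  intros Hc c2 T N3 N4 N5 N6 N7.
  assert (H2 := path_vertex (w ++ [y1]) y2 y3 N3).
  assert (H3 := path_vertex ((w ++ [y1]) ++ [y2]) y3 y4 N4).
  assert (H4 := path_vertex (((w ++ [y1]) ++ [y2]) ++ [y3]) y4 y5 N5).
  assert (H5 := path_vertex ((((w ++ [y1]) ++ [y2]) ++ [y3]) ++ [y4]) y5 y6 N6).
  assert (H6 := path_vertex (((((w ++ [y1]) ++ [y2]) ++ [y3]) ++ [y4]) ++ [y5]) y6 y7 N7).
  (* The octagon closes: its last vertex is [w y8^-1], a neighbour of [w], so the edge bound applies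
     directly. *)
  assert (H7 : r * f w <= f ((((((w ++ [y1]) ++ [y2]) ++ [y3]) ++ [y4]) ++ [y5]) ++ [y6] ++ [y7])).
  { assert (E : f ((((((w ++ [y1]) ++ [y2]) ++ [y3]) ++ [y4]) ++ [y5]) ++ [y6] ++ [y7])
                = f (w ++ [linv y8])); [| rewrite E; apply r_bound].
    apply f_J2. rewrite <- !app_assoc. simpl.
    apply J2_eq_trans with (w ++ [y1; y2; y3; y4; y5; y6; y7] ++ [y8; linv y8]).
    - apply J2_eq_sym.
      pose proof (J2_trivial_context (w ++ [y1; y2; y3; y4; y5; y6; y7]) [] _
                    (J2_trivial_cancel y8)) as K.
      now rewrite !app_nil_r, <- app_assoc in K.
    - exact (J2_trivial_context w [linv y8] _ T). }
  rewrite app_assoc in H7. rewrite <- Hc in *.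
  set (v2 := f ((w ++ [y1]) ++ [y2])) in *.
  set (v1 := f (w ++ [y1])) in *.
  revert H2 H3 H4 H5 H6 H7. generalize dependent v1. generalize dependent v2.
  generalize (f (((w ++ [y1]) ++ [y2]) ++ [y3])).
  generalize (f ((((w ++ [y1]) ++ [y2]) ++ [y3]) ++ [y4])).
  generalize (f (((((w ++ [y1]) ++ [y2]) ++ [y3]) ++ [y4]) ++ [y5])).
  generalize (f ((((((w ++ [y1]) ++ [y2]) ++ [y3]) ++ [y4]) ++ [y5]) ++ [y6])).
  generalize (f (((((((w ++ [y1]) ++ [y2]) ++ [y3]) ++ [y4]) ++ [y5]) ++ [y6]) ++ [y7])).
  intros v7 v6 v5 v4 v3 v2 v1 H2 H3 H4 H5 H6 H7.
  (* the multipliers form the first row of the adjugate of [c - path] *)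
  assert (C2 : 4 <= c ^ 2) by nra.
  assert (C3 : 0 <= c * (c ^ 2 - 2)) by (apply Rmult_le_pos; lra).
  assert (C4 : 0 <= c ^ 2 * (c ^ 2 - 3)) by (apply Rmult_le_pos; lra).
  apply Rmult_le_compat_l with (r := c ^ 4 - 3 * c ^ 2 + 1) in H2; [| lra].
  apply Rmult_le_compat_l with (r := c ^ 3 - 2 * c) in H3; [| lra].
  apply Rmult_le_compat_l with (r := c ^ 2 - 1) in H4; [| lra].
  apply Rmult_le_compat_l with (r := c) in H5; [| lra].
  lra.
Qed.

(** At [w q] three neighbours are kept: [w] and the next vertex of each octagon through the edge.
    The five others leave the factor [L - 5 r = c + r]. Multiplying by [e] and inserting
    [octagon_step] twice eliminates the two octagon vertices. *)
Lemma two_octagons_step (c : R) :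
  c = L - 6 * r -> 2 <= c -> 0 < r ->
  let e := c ^ 5 - 4 * c ^ 3 + 3 * c in
  let b := (c + r) * e - 2 * (c ^ 4 - 3 * c ^ 2 + 1) in
  0 < b /\ edge_bound ((e + 2 * r) / b).
Proof.
  intros Hc c2 r0 e b.
  assert (e0 : 0 < e).
  { unfold e. replace (_ + _) with (c * ((c ^ 2 - 1) * (c ^ 2 - 3))) by ring.
    apply Rmult_lt_0_compat; [lra |]. apply Rmult_lt_0_compat; nra. }
  apply edge_bound_div; [lra |]. intros w q.
  assert (Key : forall y z,
    (c ^ 4 - 3 * c ^ 2 + 1) * f (w ++ [q]) + r * f w <= e * f ((w ++ [q]) ++ [y]) ->
    (c ^ 4 - 3 * c ^ 2 + 1) * f (w ++ [q]) + r * f w <= e * f ((w ++ [q]) ++ [z]) ->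
    y <> linv q -> z <> linv q -> y <> z ->
    (e + 2 * r) * f w <= b * f (w ++ [q])).
  { intros y z Hy Hz Ny Nz Nyz.
    assert (H := superharmonic_neighbours (w ++ [q]) [linv q; y; z]).
    simpl map in H. rewrite f_back in H. simpl in H.
    assert (H1 : f w + (f ((w ++ [q]) ++ [y]) + (f ((w ++ [q]) ++ [z]) + 0))
                 <= (L - (8 - (1 + 1 + 1)) * r) * f (w ++ [q])).
    { apply H. repeat constructor; simpl; intuition congruence. }
    apply Rmult_le_compat_l with (r := e) in H1; [| lra].
    replace L with (c + 6 * r) in H1 by lra.
    unfold b. lra. }
  assert (Rot : forall n, J2_trivial (skipn n relator ++ firstn n relator)).
  { intros n. apply J2_trivial_rotate. rewrite firstn_skipn. apply J2_trivial_relator. }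
  assert (RotInv : forall n, J2_trivial (skipn n (winv relator) ++ firstn n (winv relator))).
  { intros n. apply J2_trivial_rotate. rewrite firstn_skipn.
    apply J2_trivial_winv, J2_trivial_relator. }
  (* position of [q] in the relator and in its inverse *)
  set (pos := match q with
    | (a1, false) => (0, 5)%nat | (b1, false) => (1, 4)%nat
    | (a1, true) => (2, 7)%nat  | (b1, true) => (3, 6)%nat
    | (a2, false) => (4, 1)%nat | (b2, false) => (5, 0)%nat
    | (a2, true) => (6, 3)%nat  | (b2, true) => (7, 2)%nat
    end).
  specialize (Rot (fst pos)). specialize (RotInv (snd pos)).
  (* Both rotated words now start with [q]; their second letters become [y] and [z]. *)
  destruct q as [[] []]; simpl in Rot, RotInv;
  (eapply Key;
   [ eapply octagon_step; [exact Hc | exact c2 | exact Rot | discriminate ..]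
   | eapply octagon_step; [exact Hc | exact c2 | exact RotInv | discriminate ..]
   | discriminate | discriminate | discriminate ]).
Qed.

End Bootstrap.

(** * The numerical contradiction *)

Lemma superharmonic_const_bound : L <> 52984 / 10000.
Proof.
  intros HL.
  destruct best_edge_bound as [r [r0 [Hr Hmax]]].
  destruct (tree_step r Hr) as [p1 B1]. apply Hmax in B1.
  assert (T : 1 <= r * (L - 7 * r)).
  { apply Rmult_le_compat_r with (r := L - 7 * r) in B1; [| lra].
    rewrite Rinv_l in B1; lra. }
  rewrite HL in T.
  (* The roots of [7 r^2 - L r + 1] are about 0.3592 and 0.3978; the bounds are rounded outwards. *)
  assert (r1 : 358 / 1000 <= r) by (clear - T; nra).
  assert (r2 : r <= 3985 / 10000) by (clear - T; nra).
  destruct (two_octagons_step r Hr _ eq_refl) as [p2 B2]; [lra | lra |].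
  apply Hmax in B2. apply Rle_div_l in B2; [| exact p2].
  rewrite HL in B2. clear - r1 r2 B2.
  set (c := 52984 / 10000 - 6 * r) in *.
  assert (Hc : 2 <= c) by (unfold c; lra).
  (* Both [c^5 - 4c^3 + 3c] and [c^4 - 3c^2 + 2] are divisible by [c^2 - 1]; cancelling it leaves
     degree 5 in [r]. *)
  assert (Q : (c ^ 2 - 1) * (c * (c ^ 2 - 3) * (1 - r * (c + r)) + 2 * r * (c ^ 2 - 2)) <= 0)
    by lra.
  assert (Q' : c * (c ^ 2 - 3) * (1 - r * (c + r)) + 2 * r * (c ^ 2 - 2) <= 0).
  { apply Rmult_le_reg_l with (c ^ 2 - 1); [clear - Hc; nra | lra]. }
  clear Q B2 Hc. unfold c in Q'. clear c.
  (* The polynomial in [r] is nearly minimal at [3/8]; its quadratic part there is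
     positive definite and dominates the cubic term. *)
  set (d := r - 375 / 1000). assert (Hd : r = d + 375 / 1000) by (unfold d; lra).
  clearbody d. subst r.
  assert (D1 : -17 / 1000 <= d) by lra. assert (D2 : d <= 235 / 10000) by lra.
  (* The coefficients of [d^3], [d^4], [d^5] are about -1123, about 1980 and exactly -1080. *)
  assert (D3 : d ^ 2 * (1123 * d) <= d ^ 2 * 30) by nra.
  assert (D4 : 0 <= d ^ 4 * (1980 - 1080 * d)).
  { apply Rmult_le_pos; [| lra]. replace (d ^ 4) with ((d ^ 2) ^ 2) by ring. apply pow2_ge_0. }
  nra.
Qed.

End Superharmonic.

(** * The Green function of the walk *)

Lemma ret_S n w : ret (S n) w = / 8 * letter_sum (fun s => ret n (w ++ [s])).
Proof. reflexivity. Qed.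

Lemma letter_term_le (f : letter -> R) (x : letter) :
  (forall y, 0 <= f y) -> f x <= letter_sum f.
Proof.
  intros H. assert (K := letter_sum_ge f 0 [x] H). simpl in K.
  refine (Rle_trans _ _ _ _ (K _)); [lra |].
  constructor; [easy | constructor].
Qed.

Lemma ret_nonneg n w : 0 <= ret n w.
Proof.
  revert w. induction n as [| n IH]; intros w.
  - simpl. unfold indic. destruct excluded_middle_informative; lra.
  - rewrite ret_S. apply Rmult_le_pos; [lra |].
    apply Rle_trans with (ret n (w ++ [(a1, false)])); [apply IH |].
    apply (letter_term_le (fun s => ret n (w ++ [s]))). intros y. apply IH.
Qed.

Lemma ret_J2 n u v : J2_eq u v -> ret n u = ret n v.
Proof.
  revert u v. induction n as [| n IH]; intros u v H.
  - simpl. unfold indic, J2_trivial.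
    destruct (excluded_middle_informative (J2_eq u [])) as [Hu | Hu],
             (excluded_middle_informative (J2_eq v [])) as [Hv | Hv]; try reflexivity.
    + destruct Hv. exact (J2_eq_trans _ _ _ (J2_eq_sym _ _ H) Hu).
    + destruct Hu. exact (J2_eq_trans _ _ _ H Hv).
  - rewrite !ret_S. f_equal. unfold letter_sum. f_equal. apply map_ext.
    intros s. apply IH. exact (J2_eq_context [] [s] _ _ H).
Qed.

Lemma ret_step n w x : ret n (w ++ [x]) <= 8 * ret (S n) w.
Proof.
  rewrite ret_S.
  assert (H := letter_term_le (fun s => ret n (w ++ [s])) x (fun s => ret_nonneg n (w ++ [s]))).
  simpl in H. lra.
Qed.

Section Green.

Variable t : R.
Hypothesis t_pos : 0 < t.
Hypothesis green_finite : ex_series (fun n => return_prob n * t ^ n).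

Lemma green_term_nonneg w n : 0 <= ret n w * t ^ n.
Proof. apply Rmult_le_pos; [apply ret_nonneg | apply pow_le; lra]. Qed.

(** Convergence spreads from the identity letter by letter: by [ret_step] the series at [w x] is
    dominated by a multiple of the shifted series at [w]. *)
Lemma ex_series_ret w : ex_series (fun n => ret n w * t ^ n).
Proof.
  induction w as [| x w IH] using rev_ind; [exact green_finite |].
  apply (@ex_series_le R_AbsRing R_CompleteNormedModule _ (fun n => (8 / t) * (ret (S n) w * t ^ S n))).
  - intros n. change (norm ?z) with (Rabs z).
    rewrite Rabs_pos_eq by apply green_term_nonneg.
    replace (8 / t * _) with (8 * ret (S n) w * t ^ n) by (simpl pow; field; lra).
    apply Rmult_le_compat_r; [apply pow_le; lra | apply ret_step].
  - apply (ex_series_scal (8 / t) (fun n => ret (S n) w * t ^ S n)).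
    apply (ex_series_incr_1 (fun n => ret n w * t ^ n)). exact IH.
Qed.

Definition green (w : list letter) : R := Series (fun n => ret n w * t ^ n).

Lemma green_J2 u v : J2_eq u v -> green u = green v.
Proof. intros H. apply Series_ext. intros n. now rewrite (ret_J2 n u v H). Qed.

Lemma green_nonneg w : 0 <= green w.
Proof.
  rewrite <- (Rmult_0_l (green w)). unfold green. rewrite <- Series_scal_l.
  apply Series_le; [| apply ex_series_ret].
  intros n. assert (H := green_term_nonneg w n). lra.
Qed.

(** First-step decomposition: the term [n = 0] is split off and the recursion of [ret] is summed
    over the rest. *)
Lemma green_equation w :
  green w = ret 0 w + t / 8 * letter_sum (fun s => green (w ++ [s])).
Proof.
  assert (Lin : forall l : list letter,
    is_series (fun n => fold_right Rplus 0 (map (fun s => ret n (w ++ [s]) * t ^ n) l))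
              (fold_right Rplus 0 (map (fun s => green (w ++ [s])) l))).
  { intros l. induction l as [| x l IH]; simpl.
    - apply (is_series_ext (fun n => 0 * (ret n w * t ^ n))); [intros; apply Rmult_0_l |].
      assert (K := is_series_scal 0 _ _ (Series_correct _ (ex_series_ret w))).
      change (scal 0 ?z) with (0 * z) in K. now rewrite Rmult_0_l in K.
    - apply (is_series_plus (fun n => ret n (w ++ [x]) * t ^ n)); [| exact IH].
      apply Series_correct, ex_series_ret. }
  unfold green at 1. rewrite Series_incr_1 by apply ex_series_ret.
  f_equal; [simpl; ring |].
  rewrite <- (is_series_unique _ _ (Lin S_letters) : _ = letter_sum _).
  rewrite <- Series_scal_l. apply Series_ext. intros n.
  rewrite ret_S. unfold letter_sum. simpl. field.
Qed.

Lemma green_superharmonic w : letter_sum (fun s => green (w ++ [s])) <= 8 / t * green w.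
Proof.
  rewrite (green_equation w). assert (H := ret_nonneg 0 w).
  replace (8 / t * _) with (8 / t * ret 0 w + letter_sum (fun s => green (w ++ [s])))
    by (field; lra).
  assert (0 <= 8 / t * ret 0 w); [| lra].
  apply Rmult_le_pos; [| easy]. apply Rlt_le, Rdiv_lt_0_compat; lra.
Qed.

(** At the identity the term [n = 0] is 1. The equation at [w x] contains the value at [w], so
    positivity spreads along words. *)
Lemma green_pos w : 0 < green w.
Proof.
  assert (E1 : 0 < green []).
  { rewrite green_equation.
    assert (H := letter_term_le (fun s => green ([] ++ [s])) (a1, false)
                   (fun s => green_nonneg ([] ++ [s]))).
    assert (H1 := green_nonneg ([] ++ [(a1, false)])).
    assert (H2 : 0 <= t / 8 * letter_sum (fun s => green ([] ++ [s]))).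
    { apply Rmult_le_pos; [lra | exact (Rle_trans _ _ _ H1 H)]. }
    replace (ret 0 []) with 1; [lra |].
    simpl. unfold indic. destruct excluded_middle_informative as [_ | N]; [easy |].
    destruct N. apply rst_refl. }
  induction w as [| x w IH] using rev_ind; [exact E1 |].
  rewrite (green_equation (w ++ [x])).
  assert (H := letter_term_le (fun s => green ((w ++ [x]) ++ [s])) (linv x)
                 (fun s => green_nonneg ((w ++ [x]) ++ [s]))).
  cbv beta in H. rewrite (f_back green green_J2) in H.
  assert (H1 := ret_nonneg 0 (w ++ [x])).
  assert (H2 : 0 < t / 8 * letter_sum (fun s => green ((w ++ [x]) ++ [s]))); [| lra].
  apply Rmult_lt_0_compat; lra.
Qed.

End Green.

(** Here [8 / t = 8 * 0.6623 = 5.2984], exactly the excluded constant. *)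
Lemma green_diverges : ~ ex_series (fun n => return_prob n * (/ (6623 / 10000)) ^ n).
Proof.
  intros H. set (t := / (6623 / 10000)) in *.
  assert (t_pos : 0 < t) by (unfold t; lra).
  apply (superharmonic_const_bound (green t) (8 / t)).
  - apply green_J2.
  - apply green_pos; assumption.
  - apply green_superharmonic; assumption.
  - unfold t. field.
Qed.

(** * From the limsup to a geometric majorant *)

Lemma nth_root_lt x r n :
  0 <= x -> 0 <= r -> (0 < n)%nat -> nth_root x n < r -> x <= r ^ n.
Proof.
  unfold nth_root. intros x0 r0 n0 H. destruct (Req_EM_T x 0) as [-> | N].
  - apply pow_le; lra.
  - assert (xp : 0 < x) by lra.
    assert (np : 0 < INR n) by now apply lt_0_INR.
    replace x with (Rpower x (/ INR n) ^ n).
    + apply pow_incr. split; [apply Rlt_le, exp_pos | lra].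
    + rewrite <- Rpower_pow by apply exp_pos.
      rewrite Rpower_mult, Rinv_l by lra. now apply Rpower_1.
Qed.

Lemma LimSup_seq_lt (u : nat -> R) (a : R) :
  0 < a -> Rbar_lt (LimSup_seq u) a ->
  exists r, 0 < r < a /\ exists N, forall n, (N <= n)%nat -> u n < r.
Proof.
  intros a0 H. assert (C : is_LimSup_seq u (LimSup_seq u)) by exact (proj2_sig (ex_LimSup_seq u)).
  destruct (LimSup_seq u) as [l | |]; simpl in H, C.
  (* The maximum keeps [r] positive even if [l] is negative. *)
  - set (r := Rmax (a / 2) ((l + a) / 2)).
    exists r. split.
    + unfold r. split; [apply Rlt_le_trans with (a / 2); [lra | apply Rmax_l] |].
      apply Rmax_lub_lt; lra.
    + assert (e0 : 0 < (a - l) / 2) by lra.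
      destruct (C (mkposreal _ e0)) as [_ [N HN]]. exists N. intros n Hn.
      specialize (HN n Hn). simpl in HN.
      apply Rlt_le_trans with ((l + a) / 2); [lra | apply Rmax_r].
  - contradiction.
  - exists (a / 2). split; [lra |]. destruct (C (a / 2)) as [N HN]. now exists N.
Qed.

Theorem mainTheorem7 : Rbar_le (Finite (6623 / 10000)) spectral_radius_J2.
Proof.
  apply Rbar_not_lt_le. intros H.
  apply LimSup_seq_lt in H; [| lra]. destruct H as [r [Hr [N HN]]].
  apply green_diverges. set (a := 6623 / 10000) in *.
  (* Starting at [S N] instead of [N] keeps every index positive, as [nth_root_lt] requires. *)
  apply (ex_series_incr_n _ (S N)).
  apply (@ex_series_le R_AbsRing R_CompleteNormedModule _ (fun n => (r / a) ^ (S N) * (r / a) ^ n)).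
  - intros n. rewrite <- pow_add. set (m := (S N + n)%nat).
    change (norm ?z) with (Rabs z).
    rewrite Rabs_pos_eq by (apply green_term_nonneg, Rinv_0_lt_compat; lra).
    unfold Rdiv. rewrite Rpow_mult_distr.
    apply Rmult_le_compat_r; [apply pow_le, Rlt_le, Rinv_0_lt_compat; lra |].
    apply nth_root_lt; [apply ret_nonneg | lra | unfold m; lia |].
    apply HN. unfold m. lia.
  - apply (ex_series_scal ((r / a) ^ S N) (fun n => (r / a) ^ n)), ex_series_geom.
    assert (0 < r / a) by (apply Rdiv_lt_0_compat; lra).
    rewrite Rabs_pos_eq by lra. apply Rlt_div_l; lra.
Qed.
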